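(* Let $C_k$ denote the $k$th Catalan number. As $n\to\infty$ over the positive integers, \[ \sum_{k=0}^n C_k = \frac{4^{n+1}}{3n\sqrt{\pi n}} \left(1-\frac{5}{8\,n}+\frac{475}{384\,n^2}+\frac{1225}{9216\,n^3}+O(n^{-4})\right). \]
   Context: For a natural number $k\ge 0$, the $k$th Catalan number is $C_k=\frac{1}{k+1}\binom{2k}{k}=\binom{2k}{k}-\binom{2k}{k+1}$. *)

(* Defs.v *)
From mathcomp Require Import all_boot.

Set Implicit Arguments.
Unset Strict Implicit.
Unset Printing Implicit Defensive.

(* The division is exact, see mul_catalan. *)
Definition catalan (k : nat) : nat := 'C(2 * k, k) %/ k.+1.

Lemma catalan_sub k : catalan k = 'C(2 * k, k) - 'C(2 * k, k.+1).
Proof.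
have E : k.+1 * 'C(2 * k, k.+1) = k * 'C(2 * k, k).
  by rewrite mul_bin_left mul2n -addnn addnK.
rewrite /catalan -[RHS](@mulKn _ k.+1) //; congr (_ %/ _).
by rewrite mulnBr E mulSn addnK.
Qed.

Lemma mul_catalan k : k.+1 * catalan k = 'C(2 * k, k).
Proof.
have E : k.+1 * 'C(2 * k, k.+1) = k * 'C(2 * k, k).
  by rewrite mul_bin_left mul2n -addnn addnK.
by rewrite catalan_sub mulnBr E mulSn addnK.
Qed.

(* Main.v *)
Require Import Defs.
From mathcomp Require Import all_boot all_order all_algebra.
From mathcomp Require Import all_classical all_reals all_analysis.
From mathcomp Require Import ring lra.
Import Order.TTheory GRing.Theory Num.Theory.
Import numFieldNormedType.Exports.
Local Open Scope classical_set_scope.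
Local Open Scope ring_scope.

(** Write [c_n] for the central binomial coefficient 'C(2n, n) and [x] for
    [1 / n]. The expansion is the product of two expansions: one for the sum of
    the Catalan numbers in terms of [c_n], one for [c_n] itself.

    The Catalan numbers grow like powers of 4, so their sum is comparable to its
    last term. Summing [c_k / (k+1)] by parts four times gives
    [c_n * catalan_main n], where [catalan_main] is an explicit rational
    function of [n], and leaves a remainder whose increments are positive and of
    order [c_n / n ^ 5] ([catalan_remS]). As [c_n] grows geometrically, the
    remainder is of the same order as its increments ([catalan_rem_bound]);
    relative to the sum this is [O(x ^ 4)], and it only remains to expand the
    rational function ([catalan_main_expansion]).

    For [c_n], put [w_n = pi n (c_n / 4 ^ n) ^ 2], so that
    [w_(n+1) / w_n = (2n+1) ^ 2 / (4n(n+1))]. Let [q(x)] be the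
    Taylor polynomial of degree 3 of the inverse of [w_n]. This recurrence makes
    [w_n (q(x) - x ^ 4)] increasing and [w_n (q(x) + x ^ 4)] decreasing, and
    Wallis' product says that [w_n] tends to 1, so both tend to 1; hence
    [w_n q(x)] is within [w_n x ^ 4] of 1 ([recip_expansion_bounds]). Taking
    square roots yields the expansion of [c_n sqrt (pi n) / 4 ^ n]
    ([normalized_central_expansion]). Wallis' product itself comes from the
    monotonicity and the recurrence of the integrals of [sin ^ n]
    ([wallis_ratio_bounds]). *)

(** * Wallis integrals *)

(** The antiderivative of [sin ^+ n] given by the classical reduction formula;
    through it the Wallis integrals need no integration theory. *)
Fixpoint sin_primitive (R : realType) (n : nat) : R -> R :=
  match n with
  | 0 => id
  | 1 => fun x => - cos x
  | (m.+1 as k).+1 => fun x =>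
     (k%:R * sin_primitive R m x - cos x * sin x ^+ k) / k.+1%:R
  end.
Arguments sin_primitive {R}.

Definition wallis (R : realType) n : R :=
  sin_primitive n (pi / 2) - sin_primitive n 0.
Arguments wallis {R}.

Section Wallis.
Variable R : realType.

Lemma nat_ind2 (P : nat -> Prop) :
  P 0%N -> P 1%N -> (forall n, P n -> P n.+1 -> P n.+2) -> forall n, P n.
Proof.
move=> P0 P1 PS n; elim/ltn_ind: n => -[|[|n]] IH //.
by apply: PS; apply: IH.
Qed.

Lemma is_derive_sin_primitive n (x : R) :
  is_derive x 1 (sin_primitive n) (sin x ^+ n).
Proof.
elim/nat_ind2: n => [||n IH _].
- by rewrite expr0; exact: is_derive_id.
- by rewrite expr1 -[sin x]opprK; apply: is_deriveN.
have -> : sin_primitive n.+2 = n.+2%:R^-1 *: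
    (n.+1%:R *: sin_primitive n - cos * (sin ^+ n.+1)) :> (R -> R).
  apply/funext => y; rewrite /= fctE mulrC.
  by rewrite /GRing.scale /= fctE /GRing.scale /= exprfctE.
apply: is_derive_eq.
rewrite /GRing.scale /= /GRing.scale /= exprfctE.
have := cos2sin2 x => cs.
have -> : n.+1%:R * sin x ^+ n -
    (cos x * ((n.+1%:R * sin x ^+ n) * cos x) + sin x ^+ n.+1 * - sin x) =
    n.+2%:R * sin x ^+ n.+2.
  by rewrite !exprS; ring: cs.
by rewrite mulKf // pnatr_eq0.
Qed.

Lemma wallis0 : wallis 0 = pi / 2 :> R.
Proof. by rewrite /wallis /= subr0. Qed.

Lemma wallis1 : wallis 1 = 1 :> R.
Proof. by rewrite /wallis /= cos_pihalf cos0 oppr0 sub0r opprK. Qed.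

Lemma wallisSS n : wallis n.+2 = n.+1%:R / n.+2%:R * wallis n :> R.
Proof.
rewrite /wallis /= cos_pihalf sin0 expr0n /=.
by ring.
Qed.

(** [sin ^+ n - sin ^+ n.+1] is nonnegative between 0 and [pi / 2], so the
    difference of the two antiderivatives increases there. *)
Lemma wallis_nincr n : wallis n.+1 <= wallis n :> R.
Proof.
pose f : R -> R := sin_primitive n - sin_primitive n.+1.
have hd (x : R) : is_derive x 1 f (sin x ^+ n - sin x ^+ n.+1).
  by apply: is_deriveB; exact: is_derive_sin_primitive.
have p2 := pihalf_ge1 R.
suff : f 0 <= f (pi / 2) by rewrite /wallis /f !fctE; lra.
apply: (@ger0_derive1_le_cc _ _ 0 (pi / 2)) => [x _|x||||].
- by have [] := hd x.
- rewrite in_itv /= => /andP[x0 xp]; rewrite derive1E derive_val exprS.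
  rewrite -[X in X - _]mul1r -mulrBl mulr_ge0 ?subr_ge0 ?sin_le1 //.
  by rewrite exprn_ge0 // ltW // sin_gt0_pihalf ?x0.
- by apply: derivable_within_continuous => x _; have [] := hd x.
- by rewrite in_itv /= lexx; lra.
- by rewrite in_itv /= lexx; lra.
- lra.
Qed.

(** The factor [(n + 1) / (n + 2)] of the recurrence makes this product
    independent of [n]. *)
Lemma wallis_mul n : n.+1%:R * (wallis n * wallis n.+1) = pi / 2 :> R.
Proof.
elim: n => [|n IH]; first by rewrite wallis0 wallis1; lra.
rewrite wallisSS -IH; field.
by have x0 : 0 <= n%:R :> R by []; lra.
Qed.

End Wallis.

(** * Central binomial coefficients *)

Definition central_binomial {R : realType} (n : nat) : R := 'C(2 * n, n)%:R.

Definition wallis_ratio {R : realType} (n : nat) : R :=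
  pi * n%:R * (central_binomial n / 4 ^+ n) ^+ 2.

(** The Taylor polynomial of degree 3, in [x = 1 / n], of the inverse of
    [wallis_ratio n]. *)
Definition recip_expansion {R : realType} (x : R) : R :=
  1 + x / 4 + x ^+ 2 / 32 - x ^+ 3 / 128.

Section CentralBinomial.
Variable R : realType.
Local Notation c := (@central_binomial R).
Local Notation w := (@wallis_ratio R).

Lemma central_binomial_gt0 n : 0 < c n.
Proof. by rewrite ltr0n bin_gt0 mul2n -addnn leq_addr. Qed.

Lemma central_binomialS n :
  c n.+1 = 2 * (2 * n%:R + 1) / (n%:R + 1) * c n.
Proof.
have E : (n.+1 * 'C(2 * n.+1, n.+1) = 2 * (n.*2.+1) * 'C(2 * n, n))%N.
  have h := mul_bin_diag n.*2.+2 n; have h' := mul_bin_down n.*2.+1 n.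
  have e : (n.*2.+1 - n = n.+1)%N by rewrite -addnn subSn ?leq_addr // addnK.
  rewrite e /= in h'; rewrite /= in h.
  rewrite !mul2n doubleS -h -doubleS -!mul2n -!mulnA.
  by congr (2 * _)%N; rewrite mul2n h'.
have n0 : n%:R + 1 != 0 :> R by rewrite natr1 pnatr_eq0.
have : n.+1%:R * c n.+1 = (2 * n.*2.+1)%:R * c n by rewrite -!natrM E.
rewrite -natr1 natrM -[n.*2.+1%:R]natr1 -mul2n natrM => h.
by apply: (mulfI n0); rewrite h; field.
Qed.

Lemma wallis_even n : wallis n.*2 = pi / 2 * (c n / 4 ^+ n) :> R.
Proof.
elim: n => [|n IH]; first by rewrite wallis0 /central_binomial bin0 expr0 divr1 mulr1.
rewrite doubleS wallisSS IH central_binomialS exprS.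
rewrite -[n.*2.+2%:R]natr1 -[n.*2.+1%:R]natr1 -mul2n natrM.
have x0 : 0 <= n%:R :> R by [].
have p0 : 4 ^+ n != 0 :> R by rewrite expf_neq0.
move: (n%:R) (4 ^+ n) x0 p0 => x p x0 p0.
by field; do ?[apply/andP; split] => //; lra.
Qed.

(** Monotonicity of the Wallis integrals squeezes [wallis (2 * n) ^+ 2] between
    [wallis (2 * n) * wallis (2 * n + 1)] and
    [wallis (2 * n - 1) * wallis (2 * n)], both known from [wallis_mul]. *)
Lemma wallis_ratio_bounds n : (0 < n)%N ->
  1 - n.+1%:R^-1 <= w n <= 1.
Proof.
case: n => // n _.
have w0 : 0 <= wallis n.+1.*2 :> R.
  by rewrite wallis_even !mulr_ge0 // ?invr_ge0 ?exprn_ge0 ?pi_ge0.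
have p0 := pi_gt0 R.
have pi0 : pi != 0 :> R by rewrite gt_eqF.
have E : w n.+1 = 4 * n.+1%:R / pi * wallis n.+1.*2 ^+ 2.
  rewrite wallis_even /wallis_ratio; move: (@pi R) pi0 => p pi0; field.
  by rewrite expf_neq0.
have n0 : 0 < n.+1%:R :> R by rewrite ltr0n.
have k0 : 0 <= 4 * n.+1%:R / pi :> R by rewrite divr_ge0 ?pi_ge0 // mulr_ge0.
rewrite E; apply/andP; split.
  have h := wallis_mul R n.+1.*2.
  have h1 : (2 * n.+1%:R + 1)^-1 * (@pi R / 2) <= wallis n.+1.*2 ^+ 2.
    have -> : 2 * n.+1%:R + 1 = n.+1.*2.+1%:R :> R by rewrite -[RHS]natr1 -mul2n natrM.
    by rewrite -h mulKf ?pnatr_eq0 // expr2 ler_wpM2l // wallis_nincr.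
  apply: le_trans (ler_wpM2l k0 h1).
  have -> : 4 * n.+1%:R / pi * ((2 * n.+1%:R + 1)^-1 * (@pi R / 2)) =
      1 - (2 * n.+1%:R + 1)^-1.
    by move: (@pi R) pi0 => p pi0; field; rewrite pi0 /=; lra.
  rewrite lerB // lef_pV2 ?posrE; last by rewrite -[n.+2%:R]natr1; lra.
    by rewrite -[n.+2%:R]natr1; lra.
  by lra.
have h := wallis_mul R n.*2.+1.
have h1 : wallis n.+1.*2 ^+ 2 <= (2 * n.+1%:R)^-1 * (@pi R / 2).
  have -> : 2 * n.+1%:R = n.*2.+2%:R :> R by rewrite -doubleS -mul2n natrM.
  by rewrite -h mulKf ?pnatr_eq0 // expr2 ler_wpM2r // wallis_nincr.
apply: le_trans (ler_wpM2l k0 h1) _.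
rewrite le_eqVlt; apply/orP; left; apply/eqP.
by move: (@pi R) pi0 => p pi0; field; rewrite pi0 /=; lra.
Qed.

Lemma wallis_ratioS n : (0 < n)%N ->
  w n.+1 = (2 * n%:R + 1) ^+ 2 / (4 * n%:R * (n%:R + 1)) * w n.
Proof.
move=> n0; rewrite /wallis_ratio central_binomialS [4 ^+ n.+1]exprS -[n.+1%:R]natr1.
have x0 : 0 < n%:R :> R by rewrite ltr0n.
have p0 : 4 ^+ n != 0 :> R by rewrite expf_neq0.
move: (n%:R) (4 ^+ n) x0 p0 => x p x0 p0.
by field; do ?[apply/andP; split] => //; lra.
Qed.

Lemma wallis_ratio_gt0 n : (0 < n)%N -> 0 < w n.
Proof.
move=> n0; apply: mulr_gt0; first by rewrite mulr_gt0 ?pi_gt0 // ltr0n.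
by rewrite exprn_gt0 // divr_gt0 ?exprn_gt0 // central_binomial_gt0.
Qed.

Lemma cvg_wallis_ratio : w n.+1 @[n --> \oo] --> (1 : R).
Proof.
apply: (@squeeze_cvgr _ _ _ _ (fun n => 1 - harmonic n) (fun=> 1)).
- near=> n. have /andP[h ->] := wallis_ratio_bounds _ (ltn0Sn n).
  rewrite andbT; apply: le_trans h; rewrite lerB // /harmonic /= lef_pV2 ?posrE ?ltr0n //.
  by rewrite ler_nat.
- by rewrite -[X in _ --> X]subr0; apply: cvgB; [exact: cvg_cst|exact: cvg_harmonic].
- exact: cvg_cst.
Unshelve. all: end_near.
Qed.

Lemma cvg_wallis_ratio_mul (p : {poly R}) : p.[0] = 1 ->
  w n.+1 * p.[harmonic n] @[n --> \oo] --> (1 : R).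
Proof.
move=> p0; rewrite -[X in _ --> X]mulr1; apply: cvgM; first exact: cvg_wallis_ratio.
rewrite -p0.
apply: (@cvg_comp _ _ _ (@harmonic R) (horner p)); first exact: cvg_harmonic.
exact: continuous_horner.
Qed.

(** The sign of the right-hand side is the sign of [K] as soon as [K] dominates
    the small second term, for instance when [K] is 1 or -1: this is what fixes
    the direction in which [wallis_ratio] times the expansion varies. *)
Lemma recip_expansion_step (K x : R) : 0 < x ->
  recip_expansion x^-1 + K * x^-1 ^+ 4 -
  (2 * x + 1) ^+ 2 / (4 * x * (x + 1)) *
    (recip_expansion (x + 1)^-1 + K * (x + 1)^-1 ^+ 4) =
  (K * (16 * x ^+ 4 + 39 * x ^+ 3 + 40 * x ^+ 2 + 20 * x + 4)
   + x * (x + 1) * (5 * x ^+ 2 - 4) / 128) / (4 * x ^+ 4 * (x + 1) ^+ 5).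
Proof.
move=> x0; rewrite /recip_expansion; field.
by apply/andP; split; lra.
Qed.

Lemma cvg_wallis_ratio_recip K :
  w n.+1 * (recip_expansion n.+1%:R^-1 + K * n.+1%:R^-1 ^+ 4) @[n --> \oo] --> (1 : R).
Proof.
pose p : {poly R} := 1 + 4^-1 *: 'X + 32^-1 *: 'X^2 - 128^-1 *: 'X^3 + K *: 'X^4.
have pE x : p.[x] = recip_expansion x + K * x ^+ 4.
  by rewrite /p /recip_expansion !hornerE /=; field.
under eq_fun do rewrite -pE.
by apply: cvg_wallis_ratio_mul; rewrite pE /recip_expansion; ring.
Qed.

(** Both products tend to 1; the left one increases and the right one
    decreases, by [recip_expansion_step]. *)
Lemma recip_expansion_bounds n : (0 < n)%N ->
  let x := n%:R^-1 : R in
  w n * (recip_expansion x - x ^+ 4) <= 1 <= w n * (recip_expansion x + x ^+ 4).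
Proof.
case: n => // n _; cbv zeta.
pose f K n := w n.+1 * (recip_expansion n.+1%:R^-1 + K * n.+1%:R^-1 ^+ 4).
have f1 K : f K @ \oo --> (1 : R) := cvg_wallis_ratio_recip K.
have fS K k (x := k.+1%:R : R) : f K k - f K k.+1 = w k.+1 *
    ((K * (16 * x ^+ 4 + 39 * x ^+ 3 + 40 * x ^+ 2 + 20 * x + 4)
     + x * (x + 1) * (5 * x ^+ 2 - 4) / 128) / (4 * x ^+ 4 * (x + 1) ^+ 5)).
  rewrite -recip_expansion_step ?ltr0n // /f [w k.+2]wallis_ratioS //.
  by rewrite -[k.+2%:R]natr1 mulrBr [_ / _ * w _]mulrC !mulrA.
have h k (y : R) : 0 <= y -> 0 <= y / (4 * k.+1%:R ^+ 4 * (k.+1%:R + 1) ^+ 5).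
  by move=> y0; rewrite divr_ge0 // mulr_ge0 ?exprn_ge0 // mulr_ge0 ?exprn_ge0.
have hk k : let x := k.+1%:R : R in [/\ 0 < x, 0 < x ^+ 2, 0 < x ^+ 3 & 0 < x ^+ 4].
  by split; rewrite ?exprn_gt0.
apply/andP; split.
  have -> : w n.+1 * (recip_expansion n.+1%:R^-1 - n.+1%:R^-1 ^+ 4) = f (-1) n.
    by rewrite /f mulN1r.
  rewrite -[leRHS](cvg_lim _ (f1 (-1))) //.
  apply: nondecreasing_cvgn_le; last by apply/cvg_ex; exists 1; apply: f1.
  apply/nondecreasing_seqP => k; rewrite -subr_le0 fS mulr_ge0_le0 //.
    exact/ltW/wallis_ratio_gt0.
  rewrite -oppr_ge0 -mulNr; apply: h.
  have /= [] := hk k; move: (k.+1%:R) => x; lra.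
have -> : w n.+1 * (recip_expansion n.+1%:R^-1 + n.+1%:R^-1 ^+ 4) = f 1 n.
  by rewrite /f mul1r.
rewrite -[leLHS](cvg_lim _ (f1 1)) //.
apply: nonincreasing_cvgn_ge; last by apply/cvg_ex; exists 1; apply: f1.
apply/nonincreasing_seqP => k; rewrite -subr_ge0 fS mulr_ge0 //.
  exact/ltW/wallis_ratio_gt0.
apply: h.
have /= [] := hk k; move: (k.+1%:R) => x; lra.
Qed.

End CentralBinomial.

(** * Expansion of the central binomial coefficients *)

(** The Taylor polynomial of degree 3 of [Num.sqrt (recip_expansion x)^-1]. *)
Definition central_expansion {R : realType} (x : R) : R :=
  1 - x / 8 + x ^+ 2 / 128 + 5 * x ^+ 3 / 1024.

Definition normalized_central {R : realType} (n : nat) : R :=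
  Num.sqrt (pi * n%:R) * central_binomial n / 4 ^+ n.

Section CentralExpansion.
Variable R : realType.
Local Notation w := (@wallis_ratio R).
Local Notation u := (@normalized_central R).

Lemma exprn01 (x : R) : 0 <= x <= 1 -> forall k, 0 <= x ^+ k.+1 <= x ^+ k.
Proof.
by move=> /andP[x0 x1] k; rewrite exprn_ge0 //= exprS ler_piMl ?exprn_ge0.
Qed.

Lemma recip_central_expansion (x : R) : 0 <= x <= 1 ->
  `|central_expansion x ^+ 2 * recip_expansion x - 1| <= x ^+ 4.
Proof.
move=> x01; have h := exprn01 x x01.
have := (h 4, h 5, h 6, h 7, h 8)%N.
move=> [[[[/andP[a1 b1] /andP[a2 b2]] /andP[a3 b3]] /andP[a4 b4]] /andP[a5 b5]].
rewrite /central_expansion /recip_expansion ler_norml; apply/andP; split; lra.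
Qed.

Lemma normalized_central_sqr n : u n ^+ 2 = w n.
Proof.
rewrite /normalized_central /wallis_ratio -mulrA exprMn sqr_sqrtr //.
by rewrite mulr_ge0 ?pi_ge0.
Qed.

Lemma normalized_central_ge0 n : 0 <= u n.
Proof.
by rewrite divr_ge0 ?exprn_ge0 // mulr_ge0 ?sqrtr_ge0.
Qed.

Lemma normalized_central_le1 n : (0 < n)%N -> u n <= 1.
Proof.
move=> n0; rewrite -(@ler_pXn2r _ 2) ?nnegrE ?normalized_central_ge0 //.
rewrite expr1n normalized_central_sqr.
by have /andP[] := wallis_ratio_bounds R n n0.
Qed.

(** The square [v ^+ 2] and [b ^+ 2] have nearly the same product 1 with [q], so
    they are close; dividing by [v + b], which is at least [1 / 2], gives the
    bound on [v - b]. *)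
Lemma normalized_central_expansion n : (0 < n)%N ->
  `|u n - central_expansion n%:R^-1| <= 4 * n%:R^-1 ^+ 4.
Proof.
move=> n0.
have /andP[h1 h2] := recip_expansion_bounds R n n0.
have /andP[_ w1] := wallis_ratio_bounds R n n0.
have w0 := wallis_ratio_gt0 R n n0.
have x01 : 0 <= (n%:R^-1 : R) <= 1 by rewrite invr_ge0 ler0n /= invf_le1 ?ltr0n // ler1n.
have := recip_central_expansion _ x01.
have := exprn01 _ x01.
rewrite -normalized_central_sqr in h1 h2 w1 w0; have := normalized_central_ge0 n.
move: (u n) (n%:R^-1) x01 h1 h2 w1 w0 => v x /andP[x0 x1] h1 h2 w1 w0 v0 hx.
set b := central_expansion x; set q := recip_expansion x.
have [/andP[a1 b1] /andP[a2 b2] /andP[a3 b3] ] := (And3 (hx 1%N) (hx 2%N) (hx 3%N)).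
have q1 : 1 <= q by rewrite /q /recip_expansion; lra.
have bh : 2^-1 <= b by rewrite /b /central_expansion; lra.
have wx : v ^+ 2 * x ^+ 4 <= x ^+ 4 by rewrite ler_piMl.
rewrite ler_norml -/b -/q => /andP[k1 k2]; rewrite -/q in h1 h2.
move: (b) (q) q1 bh h1 h2 k1 k2 => {}b {}q q1 bh h1 h2 k1 k2.
have k3 : `|(v ^+ 2 - b ^+ 2) * q| <= 2 * x ^+ 4.
  by rewrite ler_norml; apply/andP; split; lra.
have k4 : `|v ^+ 2 - b ^+ 2| <= 2 * x ^+ 4.
  apply: le_trans k3; rewrite normrM ler_peMr // ger0_norm //; lra.
rewrite subr_sqr normrM in k4.
have k5 : `|v - b| * 2^-1 <= `|v - b| * `|v + b|.
  by apply: ler_wpM2l => //; rewrite ger0_norm; lra.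
lra.
Qed.

End CentralExpansion.

(** * Summation of the Catalan numbers by parts *)

(** With [T_j(n) = (2n+1) c_n / ((n+1)...(n+j))], where [c_n] is the central
    binomial coefficient, one has
    [T_j(n) - T_j(n-1) = (3/2) c_n / ((n+1)...(n+j-1))
                         - (2j-1) c_n / ((n+1)...(n+j))].
    Since [C_n = c_n / (n+1)], using this identity for [j = 2, 3, 4, 5] in turn
    expresses the sum of the Catalan numbers by [T_2, ..., T_5], whose
    coefficients are [2/3], [2/3 * 2], [2/3 * 20/3] and [2/3 * 280/9]. *)
Definition catalan_main {R : realType} (n : nat) : R :=
  let x := n%:R in
  (2 * x + 1) * (2 / 3 / ((x + 1) * (x + 2)) + 4 / 3 / ((x + 1) * (x + 2) * (x + 3))
   + 40 / 9 / ((x + 1) * (x + 2) * (x + 3) * (x + 4))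
   + 560 / 27 / ((x + 1) * (x + 2) * (x + 3) * (x + 4) * (x + 5))).

Definition catalan_rem {R : realType} (n : nat) : R :=
 \sum_(0 <= k < n.+1) (catalan k)%:R - catalan_main n * central_binomial n.

(** The expansion, in [x = 1 / n], of [3 / 4 * n * catalan_main n]. *)
Definition main_expansion {R : realType} (x : R) : R :=
  1 - x / 2 + 7 * x ^+ 2 / 6 + 5 * x ^+ 3 / 18.

Section CatalanSum.
Variable R : realType.
Local Notation c := (@central_binomial R).
Local Notation main := (@catalan_main R).
Local Notation rem := (@catalan_rem R).

Lemma catalanE n : (catalan n)%:R = c n / (n%:R + 1) :> R.
Proof.
by rewrite /central_binomial -mul_catalan natrM -natr1 mulrAC divff ?mul1r.
Qed.

(** The four summations by parts leave a single term, of order [c_n / n ^ 5]. *)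
Lemma catalan_remS n :
  rem n.+1 = rem n +
   560 / 3 * c n.+1 / ((n%:R + 2) * (n%:R + 3) * (n%:R + 4) * (n%:R + 5) * (n%:R + 6)).
Proof.
rewrite /catalan_rem [X in X - _ = _]big_nat_recr //= catalanE /catalan_main.
rewrite -natr1 central_binomialS.
have x0 : 0 <= n%:R :> R by [].
move: (n%:R) x0 => x x0.
by field; do ?[apply/andP; split]; lra.
Qed.

(** The upper bound is [1500 T_6(n)]. Its increment is
    [1500 (3n-4) c_n / (2 (n+1)...(n+6))], which exceeds that of the remainder
    once [n] is at least 2; the constant 1500 is just large enough for
    [n = 2]. *)
Lemma catalan_rem_bound n :
  0 <= rem n <= 1500 * (2 * n%:R + 1) * c n /
    ((n%:R + 1) * (n%:R + 2) * (n%:R + 3) * (n%:R + 4) * (n%:R + 5)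
     * (n%:R + 6)).
Proof.
have r0 : rem 0 = 7 / 81.
  by rewrite /catalan_rem big_nat1 catalanE /catalan_main /c bin0; field.
have r1 : rem 1 = 49 / 81.
  by rewrite catalan_remS r0 central_binomialS /c bin0; field.
elim: n => [|[|n] IH].
- set t := (X in _ <= _ <= X).
  have -> : t = 25 / 12.
    by rewrite /t /c bin0; field.
  by rewrite r0; apply/andP; split; lra.
- set t := (X in _ <= _ <= X).
  have -> : t = 25 / 14.
    by rewrite /t central_binomialS /c bin0; field.
  by rewrite r1; apply/andP; split; lra.
have [IH1 IH2] := andP IH.
have c1 := central_binomial_gt0 R n.+2.
have x0 : 0 <= n%:R :> R by [].
rewrite catalan_remS; apply/andP; split.
  apply: addr_ge0; first exact: IH1.
  clear IH IH1 IH2 r0 r1; apply: divr_ge0.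
    by apply: mulr_ge0; [lra | exact: ltW].
  by do 4?[apply: mulr_ge0; last by lra]; lra.
have e1 : c n.+1 = (n%:R + 2) / (2 * (2 * n%:R + 3)) * c n.+2.
  by rewrite [c n.+2]central_binomialS -natr1; field; do ?[apply/andP; split]; lra.
rewrite e1 in IH2.
apply: le_trans (lerD IH2 (lexx _)) _.
rewrite -[n.+2%:R]natr1 -[n.+1%:R]natr1 -subr_ge0.
move: (c n.+2) (n%:R) c1 x0 {IH IH1 IH2 e1 r0 r1} => y x y0 x0.
set z := (X in 0 <= X).
have -> : z = (6190 / 3 * x + 20 / 3) * y /
    ((x + 3) * (x + 4) * (x + 5) * (x + 6) * (x + 7) * (x + 8)).
  by rewrite /z; field; do ?[apply/andP; split]; lra.
apply: divr_ge0; first by apply: mulr_ge0; [lra | exact: ltW].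
by do 5?[apply: mulr_ge0; last by lra]; lra.
Qed.

(** Once the denominator is cleared, both inequalities are linear in the powers
    of [x], with nonnegative coefficients. *)
Lemma catalan_main_expansion n : (0 < n)%N ->
  `|3 / 4 * n%:R * main n - main_expansion n%:R^-1| <= 1000 * n%:R^-1 ^+ 4.
Proof.
move=> n0.
have y0 : 0 < n%:R :> R by rewrite ltr0n.
have x0 : 0 < (n%:R^-1 : R) by rewrite invr_gt0.
rewrite /catalan_main; move: (n%:R^-1) x0 (esym (invrK (n%:R : R))) => x x0 ->.
have den0 : 0 < (1 + x) * (1 + 2 * x) * (1 + 3 * x) * (1 + 4 * x) * (1 + 5 * x).
  by do 4?[apply: mulr_gt0; last by lra]; lra.
pose num := (2 + x) * (1 / 2 * (1 + 3 * x) * (1 + 4 * x) * (1 + 5 * x)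
  + x * (1 + 4 * x) * (1 + 5 * x) + 10 / 3 * x ^+ 2 * (1 + 5 * x) + 140 / 9 * x ^+ 3)
  - main_expansion x * ((1 + x) * (1 + 2 * x) * (1 + 3 * x) * (1 + 4 * x) * (1 + 5 * x)).
set z := (X in `|X|).
have -> : z = num / ((1 + x) * (1 + 2 * x) * (1 + 3 * x) * (1 + 4 * x) * (1 + 5 * x)).
  by rewrite /z /num /main_expansion; field; do ?[apply/andP; split]; lra.
rewrite normrM normfV [X in _ / X]gtr0_norm // ler_pdivrMr // ler_norml.
rewrite /num /main_expansion.
have h k : 0 <= x ^+ k by rewrite exprn_ge0 // ltW.
have [h4 h5 h6 h7] := And4 (h 4%N) (h 5%N) (h 6%N) (h 7%N).
have [h8 h9] := conj (h 8%N) (h 9%N).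
by apply/andP; split; lra.
Qed.

Lemma catalan_rem_expansion n : (0 < n)%N ->
  0 <= 3 / 4 * n%:R * (rem n / c n) <= 2250 * n%:R^-1 ^+ 4.
Proof.
move=> n0.
have c0 := central_binomial_gt0 R n.
have y0 : 0 < n%:R :> R by rewrite ltr0n.
have /andP[r0 r1] := catalan_rem_bound n.
apply/andP; split.
  by apply: mulr_ge0; [lra | rewrite divr_ge0 // ltW].
move: r1; rewrite [_ * c n / _]mulrAC -ler_pdivrMr // => r1.
apply: le_trans (ler_wpM2l _ r1) _; first by lra.
move: (n%:R) y0 => y y0 {r0 r1}.
have d0 : 0 < y ^+ 4 by rewrite exprn_gt0.
have den0 : 0 < (y + 1) * (y + 2) * (y + 3) * (y + 4) * (y + 5) * (y + 6).
  by do 5?[apply: mulr_gt0; last by lra]; lra.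
rewrite exprVn mulrA ler_pdivrMr // mulrAC [leRHS]mulrAC ler_pdivlMr //.
have h k : 0 <= y ^+ k by rewrite exprn_ge0 // ltW.
have [h4 h5 h2 h3] := And4 (h 4%N) (h 5%N) (h 2%N) (h 3%N).
have h6 := h 6%N.
lra.
Qed.

End CatalanSum.

(** * The asymptotic expansion *)

Definition sum_expansion {R : realType} (x : R) : R :=
  1 - 5 / 8 * x + 475 / 384 * x ^+ 2 + 1225 / 9216 * x ^+ 3.

Section Product.
Variable R : realType.

Lemma main_central_expansion (x : R) : 0 <= x <= 1 ->
  `|main_expansion x * central_expansion x - sum_expansion x| <= x ^+ 4.
Proof.
move=> x01; have h := exprn01 R x x01.
have [/andP[a4 b4] /andP[a5 b5] /andP[a6 b6]] := And3 (h 4%N) (h 5%N) (h 6%N).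
clear h; rewrite ler_norml /main_expansion /central_expansion /sum_expansion.
by apply/andP; split; lra.
Qed.

Lemma main_expansion_le2 (x : R) : 0 <= x <= 1 -> `|main_expansion x| <= 2.
Proof.
move=> x01; have h := exprn01 R x x01; case/andP: x01 => x0 x1.
have [/andP[a1 b1] /andP[a2 b2]] := conj (h 1%N) (h 2%N).
by clear h; rewrite ler_norml /main_expansion; apply/andP; split; lra.
Qed.

End Product.

Theorem theorem2 (R : realType) :
  exists2 e : nat -> R,
    e =O_\oo (fun n : nat => n%:R ^- 4 : R) &
    forall n : nat, (0 < n)%N ->
      \sum_(0 <= k < n.+1) (catalan k)%:R =
      4 ^+ n.+1 / (3 * n%:R * Num.sqrt (pi * n%:R)) *
      (1 - 5 / (8 * n%:R) + 475 / (384 * n%:R ^+ 2)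
         + 1225 / (9216 * n%:R ^+ 3) + e n) :> R.
Proof.
pose A (n : nat) : R := 4 ^+ n.+1 / (3 * n%:R * Num.sqrt (pi * n%:R)).
pose T (n : nat) : R := 1 - 5 / (8 * n%:R) + 475 / (384 * n%:R ^+ 2)
         + 1225 / (9216 * n%:R ^+ 3).
pose S (n : nat) : R := \sum_(0 <= k < n.+1) (catalan k)%:R.
have s0 n : (0 < n)%N -> 0 < Num.sqrt (pi * n%:R) :> R.
  by move=> n0; rewrite sqrtr_gt0 mulr_gt0 ?pi_gt0 ?ltr0n.
exists (fun n => S n / A n - T n); last first.
  move=> n n0; rewrite -/(S n) -/(A n) -/(T n) addrC subrK mulrC divfK //.
  rewrite /A gt_eqF // divr_gt0 ?exprn_gt0 // mulr_gt0 ?s0 //.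
  by apply: mulr_gt0; rewrite ltr0n.
apply/eqO_exP; exists 4000; first by rewrite ltr0n.
exists 1%N => // n /= n0.
(* The prefactor is [c_n * (4 / (3 * n)) / normalized_central n]. *)
have SA : S n / A n = (3 / 4 * n%:R * catalan_main n +
    3 / 4 * n%:R * (catalan_rem n / central_binomial n)) * normalized_central n.
  have -> : S n = catalan_main n * central_binomial n + catalan_rem n.
    by rewrite /catalan_rem addrC subrK.
  have c0 := central_binomial_gt0 R n.
  have p0 : 0 < 4 ^+ n :> R by rewrite exprn_gt0.
  have x0 : 0 < n%:R :> R by rewrite ltr0n.
  rewrite /A /normalized_central exprS.
  move: (n%:R) (Num.sqrt _) (central_binomial n) (4 ^+ n) x0 (s0 n n0) c0 p0.
  move=> x s d p x1 s1 d1 p1; field.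
  by do ?[apply/andP; split]; lra.
have -> : T n = sum_expansion n%:R^-1.
  by rewrite /T /sum_expansion; field; rewrite pnatr_eq0 -lt0n.
rewrite {}SA.
have := catalan_main_expansion R n n0; have := catalan_rem_expansion R n n0.
have := normalized_central_ge0 R n; have := normalized_central_le1 R n n0.
have := normalized_central_expansion R n n0.
rewrite -exprVn [`|_ ^+ 4|]ger0_norm ?exprn_ge0 ?invr_ge0 //.
have x0 : 0 < (n%:R^-1 : R) by rewrite invr_gt0 ltr0n.
have x1 : (n%:R^-1 : R) <= 1 by rewrite invf_le1 ?ltr0n // ler1n.
move: (n%:R^-1) x0 x1 (3 / 4 * n%:R * catalan_main n)
  (3 / 4 * n%:R * (catalan_rem n / central_binomial n)) (normalized_central n).
move=> x x0 x1 P G v v_exp v1 v0 /andP[G0 G1] P_exp.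
have x01 : 0 <= x <= 1 by rewrite x1 ltW.
have pb := main_central_expansion R x x01; have p2 := main_expansion_le2 R x x01.
move: (main_expansion x) (central_expansion x) (sum_expansion x) v_exp P_exp pb p2.
move=> p b t v_exp P_exp pb p2.
(* [P] and [v] are within [O(x ^ 4)] of [p] and [b], and [G] is itself
   [O(x ^ 4)]. *)
have -> : (P + G) * v - t = (P - p + G) * v + (p * (v - b) + (p * b - t)) by ring.
have t1 : `|(P - p + G) * v| <= 1000 * x ^+ 4 + 2250 * x ^+ 4.
  rewrite normrM [`|v|]ger0_norm //.
  apply: le_trans (ler_piMr (normr_ge0 _) v1) _.
  apply: le_trans (ler_normD _ _) _; rewrite [`|G|]ger0_norm //.
  exact: lerD.
have t2 : `|p * (v - b)| <= 2 * (4 * x ^+ 4) by rewrite normrM ler_pM.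
apply: le_trans (ler_normD _ _) _.
apply: le_trans (lerD t1 (le_trans (ler_normD _ _) (lerD t2 pb))) _.
have x4 : 0 <= x ^+ 4 by rewrite exprn_ge0 // ltW.
by clear -x4; lra.
Qed.
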